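(* Let $\Delta\subseteq\mathbb{R}^2$ be a two-dimensional lattice polygon. For two distinct lattice points $P,Q\in\Delta$, the following are equivalent: (1) $P,Q$ is a regular sequence for $\bigoplus_{i\ge0}V_{i\Delta}$. (2) $P,Q$ is a regular sequence for $\bigoplus_{i\ge1}V_{(i\Delta)^{(1)}}$. (3) $(q\Delta-P)\cap(q\Delta-Q)\subseteq(q-1)\Delta$ for some integer $q>1$. (4) $(q\Delta-P)\cap(q\Delta-Q)\subseteq(q-1)\Delta$ for all integers $q\ge1$. (5) $((q\Delta)^\circ-P)\cap((q\Delta)^\circ-Q)\subseteq((q-1)\Delta)^\circ$ for all integers $q\ge1$, where ${}^\circ$ denotes the interior for the standard topology on $\mathbb{R}^2$. (6) $((q\Delta)^{(1)}-P)\cap((q\Delta)^{(1)}-Q)\cap\mathbb{Z}^2\subseteq((q-1)\Delta)^{(1)}\cap\mathbb{Z}^2$ for all integers $q\ge1$. (7) $(q\Delta-P)\cap(q\Delta-Q)\cap\mathbb{Z}^2\subseteq(q-1)\Delta\cap\mathbb{Z}^2$ for all integers $q\ge1$. (8) Let $\ell$ be the line through $P$ and $Q$. For both half-planes $H$ bordered by $\ell$, the polygon $H\cap\Delta$ is a triangle with $P$ and $Q$ as two vertices (this may be degenerate, in which case it is the line segment $PQ$). (9) $\Delta$ is a quadrangle and $P$ and $Q$ are opposite vertices of this quadrangle (this may be the degenerate case where $\Delta$ is a triangle and $P,Q$ are any pair of vertices of $\Delta$).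
   Context: Let $k$ be a field of characteristic $0$. A lattice polygon is the convex hull in $\mathbb{R}^2$ of finitely many points of $\mathbb{Z}^2$. For a lattice polygon $\Gamma$, $\Gamma^{(1)}$ denotes the convex hull of the lattice points in the interior of $\Gamma$ (possibly empty). For $q\ge0$, $q\Delta=\{qv\mid v\in\Delta\}$, with $0\Delta=\{(0,0)\}$; for $A\subseteq\mathbb{R}^2$, $A-P$ is the translate of $A$ by $-P$. For $A\subseteq\mathbb{R}^2$, $V_A\subseteq k[x^{\pm1},y^{\pm1}]$ denotes the $k$-space of Laurent polynomials whose monomials $x^iy^j$ all satisfy $(i,j)\in A\cap\mathbb{Z}^2$. Both $\bigoplus_{i\ge0}V_{i\Delta}$ and $\bigoplus_{i\ge1}V_{(i\Delta)^{(1)}}$ are graded modules (the index $i$ is the degree) over the polynomial ring $S_\Delta=k[X_{a,b}\mid(a,b)\in\Delta\cap\mathbb{Z}^2]$, where $X_{a,b}$ acts as multiplication by $x^ay^b$, raising the degree by one. A lattice point $P=(a,b)\in\Delta$ is identified with the variable $X_{a,b}$. A sequence of points $P_1,\dots,P_m$ of $\Delta\cap\mathbb{Z}^2$ is a regular sequence for such a module $M$ if for each $i=1,\dots,m$ multiplication by $P_i$ is injective on $M/(P_1M+\dots+P_{i-1}M)$.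
   Formalization: In (9) the quadrangle may also have a straight angle at a vertex, so P may lie inside an edge of a triangle with Q the opposite vertex (or vice versa); read literally (9) fails for Δ=conv{(-1,0),(1,0),(0,1)}, P=(0,0), Q=(0,1), where (8) holds. *)

(* Defs.v *)
From mathcomp Require Import all_boot all_order all_algebra.
From mathcomp Require Import boolp classical_sets functions cardinality reals.
From mathcomp Require Import topology normedtype convex.

Set Implicit Arguments.
Unset Strict Implicit.
Unset Printing Implicit Defensive.

Import Order.TTheory GRing.Theory Num.Theory numFieldNormedType.Exports.

Local Open Scope classical_set_scope.
Local Open Scope ring_scope.

Section PlaneGeometry.
Context {R : realType}.
Implicit Types (A B C D : R * R) (S H l : set (R * R)).

Definition lattice_pt (u : int * int) : R * R := (u.1%:~R, u.2%:~R).

Definition Zlattice : set (R * R) := range lattice_pt.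

Definition hull S : set (R * R) := smallest (@convex_set R (R * R)%type) S.

Definition lattice_polygon S : Prop :=
  exists s : seq (int * int), S = hull (lattice_pt @` [set` s]).

(* The determinant of (B - A, C - A): positive iff A, B, C turn
   counterclockwise, zero iff they are collinear. *)
Definition orient A B C : R :=
  (B.1 - A.1) * (C.2 - A.2) - (B.2 - A.2) * (C.1 - A.1).

Definition two_dimensional S : Prop :=
  exists A B C, [/\ S A, S B, S C & orient A B C != 0].

Definition dilate (q : nat) S : set (R * R) := [set q%:R *: v | v in S].

(* The translate S - A of S by - A. *)
Definition translN S A : set (R * R) := [set v - A | v in S].

(* S^(1); the interior is that of the plane, so this is empty when S is
   contained in a line, in particular for S = 0 Delta. *)
Definition inner_hull S : set (R * R) := hull (S° `&` Zlattice).

Definition line A B : set (R * R) := [set A + t *: (B - A) | t in setT].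

(* The coefficients (a, b, c) and (- a, - b, - c) describe the same line l but
   opposite half-planes, so each line borders exactly two sets H. *)
Definition halfplane_bordered_by l H : Prop :=
  exists a b c : R, [/\ (a, b) != (0, 0),
    l = [set v | a * v.1 + b * v.2 = c] &
    H = [set v | c <= a * v.1 + b * v.2]].

Definition triangle A B C S : Prop :=
  orient A B C != 0 /\ S = hull [set A; B; C].

(* S is the convex quadrangle with vertices A, B, C, D in counterclockwise
   order; its opposite vertices are A, C and B, D. Straight angles are allowed:
   a triangle QBD with a point P marked inside its edge BD is a degenerate
   quadrangle P, B, Q, D (or P, D, Q, B). *)
Definition quadrangle A B C D S : Prop :=
  [/\ uniq [:: A; B; C; D],
      0 <= orient A B C /\ 0 <= orient B C D,
      0 <= orient C D A /\ 0 <= orient D A B &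
      S = hull [set A; B; C; D]].

End PlaneGeometry.

Section GradedModules.
Context {k : fieldType} {R : realType}.

(* A Laurent polynomial is encoded by its coefficients: f u is the coefficient
   of x ^ u.1 * y ^ u.2, and f must have finite support. *)
Definition laurent_space (S : set (R * R)) : set (int * int -> k) :=
  [set f | finite_set [set u | f u != 0] /\
           forall u, f u != 0 -> S (lattice_pt u)].

Definition mul_monomial (P : int * int) (f : int * int -> k) :
  int * int -> k := fun u => f (u - P).

(* The direct sum over i in I of the laurent_space (S i), seen inside the
   functions of the degree i. *)
Definition direct_sum (I : set nat) (S : nat -> set (R * R)) :
    set (nat -> int * int -> k) :=
  [set F | [/\ finite_set [set i | F i != 0],
               forall i, I i -> laurent_space (S i) (F i) &
               forall i, ~ I i -> F i = 0]].

(* The action of the variable X_P, which raises the degree by one. *)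
Definition actX (P : int * int) (F : nat -> int * int -> k) :
    nat -> int * int -> k :=
  fun i => if i is j.+1 then mul_monomial P (F j) else 0.

(* actX P_1 M + ... + actX P_m M *)
Definition image_sum (M : set (nat -> int * int -> k)) (s : seq (int * int)) :
    set (nat -> int * int -> k) :=
  [set \sum_(j < size s) actX s`_j (G j) |
     G in [set G : 'I_(size s) -> nat -> int * int -> k | forall j, M (G j)]].

(* Elements of M / N are equal iff the difference of their representatives
   lies in N. *)
Definition injective_mod (M N : set (nat -> int * int -> k))
    (P : int * int) : Prop :=
  forall F G, M F -> M G -> N (actX P F - actX P G) -> N (F - G).

Definition regular_sequence (M : set (nat -> int * int -> k))
    (s : seq (int * int)) : Prop :=
  forall i, (i < size s)%N -> injective_mod M (image_sum M (take i s)) s`_i.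

Definition polygon_module (S : set (R * R)) : set (nat -> int * int -> k) :=
  direct_sum setT (fun i => dilate i S).

Definition inner_module (S : set (R * R)) : set (nat -> int * int -> k) :=
  direct_sum [set i | (0 < i)%N] (fun i => inner_hull (dilate i S)).

End GradedModules.

Arguments polygon_module k {R} S.
Arguments inner_module k {R} S.

(* Main.v *)
(* Call a linear form extremal at a point r of Delta when it attains its maximum
   over Delta at r. If such a form takes a smaller value at q, then n r - q lies
   outside (n - 1) Delta for every n; so the shift conditions (3) and (7) forbid
   that n r - (q - p) lies in n Delta, i.e. that r can be moved inside Delta in
   the direction p - q (for the single n of (3), r is replaced by a point of the
   segment q r). For (6), n r is first translated into the interior of
   (n + 3) Delta by a fixed lattice point, and q is subtracted often enough to
   outweigh this translation.
   Now let m and m' be vertices of Delta farthest from the line p q on its two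
   sides. Every other vertex can be moved inside Delta along one of the
   directions +-(q - p), so that Delta is the hull of p, m', q, m; and if the
   segment m m' did not meet p q, then its intersection with the line through p
   and q could be moved too. So (3), (6) and (7) each give (9).
   Conversely (9) cuts Delta along p q into triangles, and in a triangle p q A
   (4) follows from the uniqueness of barycentric coordinates; interiors and
   lattice points then give (5), (6), (7). Finally (1) and (2) are (7) and (6) in
   terms of monomials: the relation X_Q F = X_P G forces F = X_P G', where the
   support of G' is contained in the intersection of the two translates. *)

Require Import Defs.
From mathcomp Require Import all_boot all_order all_algebra.
From mathcomp Require Import boolp classical_sets functions cardinality reals.
From mathcomp Require Import topology normedtype convex.
From mathcomp Require Import interval_inference ring lra.

Set Implicit Arguments.
Unset Strict Implicit.
Unset Printing Implicit Defensive.

Import Order.TTheory GRing.Theory Num.Theory numFieldNormedType.Exports.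

Local Open Scope classical_set_scope.
Local Open Scope ring_scope.

(** * Hulls, dilates and translates in coordinates *)

Section Plane.
Context {R : realType}.
Implicit Types (A B C D x y z p q : R * R) (S T : set (R * R)) (t : R).

Lemma pointP x y : x.1 = y.1 -> x.2 = y.2 -> x = y.
Proof. by case: x y => [? ?] [? ?] /= -> ->. Qed.

Lemma scale1E t x : (t *: x).1 = t * x.1. Proof. by []. Qed.
Lemma scale2E t x : (t *: x).2 = t * x.2. Proof. by []. Qed.
Lemma add1E x y : (x + y).1 = x.1 + y.1. Proof. by []. Qed.
Lemma add2E x y : (x + y).2 = x.2 + y.2. Proof. by []. Qed.
Lemma opp1E x : (- x).1 = - x.1. Proof. by []. Qed.
Lemma opp2E x : (- x).2 = - x.2. Proof. by []. Qed.

Definition coordE :=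
  (scale1E, scale2E, add1E, add2E, opp1E, opp2E).

(** Trades weights bundled in the unit interval for a real [t] with two inequalities, so that [lra]
    and [nra] apply. *)
Lemma convexP S : @convex_set R (R * R)%type S <->
  forall x y t, 0 <= t -> t <= 1 -> S x -> S y -> S (t *: x + (1 - t) *: y).
Proof.
split=> [cS x y t t0 t1 Sx Sy|cS x y t /set_mem Sx /set_mem Sy].
  by apply/set_mem/(cS x y (Itv01 t0 t1)); exact/mem_set.
by apply/mem_set; apply: cS.
Qed.

Definition linear_form (a b : R) x : R := a * x.1 + b * x.2.

Lemma convex_halfplane (a b c : R) :
  @convex_set R (R * R)%type [set v | linear_form a b v <= c].
Proof.
apply/convexP => x y t t0 t1 /=; rewrite /linear_form !coordE => Sx Sy; nra.
Qed.

Lemma hull_convex S : @convex_set R (R * R)%type (hull S).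
Proof.
apply/convexP => x y t t0 t1 Sx Sy T [cT ST].
by have /convexP := cT; apply=> //; [exact: Sx|exact: Sy].
Qed.

Lemma hull_conv S x y t : 0 <= t -> t <= 1 -> hull S x -> hull S y ->
  hull S (t *: x + (1 - t) *: y).
Proof. by have /convexP := @hull_convex S; apply. Qed.

Lemma sub_hull S : S `<=` hull S.
Proof. exact: sub_gen_smallest. Qed.

Lemma hull_sub S T : @convex_set R (R * R)%type T -> S `<=` T -> hull S `<=` T.
Proof. exact: smallest_sub. Qed.

Lemma hullS S T : S `<=` T -> hull S `<=` hull T.
Proof. by move=> ST; apply: hull_sub; [exact: hull_convex|exact: subset_trans ST (@sub_hull _)]. Qed.

(** The points may be dependent: with [B = C] this is a segment, so one computation serves both the
    triangle and the degenerate case of (8). *)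
Definition simplex A B C : set (R * R) :=
  [set x | exists a b c : R, [/\ 0 <= a, 0 <= b, 0 <= c, a + b + c = 1 &
    x = a *: A + b *: B + c *: C]].

(** The combinations form a convex set containing the three points. Conversely, each one mixes [C]
    with a point of the segment [A B], whose weights are renormalized by [a + b]. *)
Lemma hull3E A B C : hull [set A; B; C] = simplex A B C.
Proof.
apply/seteqP; split.
- apply: hull_sub.
    apply/convexP => _ _ t t0 t1 [a [b [c [a0 b0 c0 abc ->]]]]
      [a' [b' [c' [a'0 b'0 c'0 abc' ->]]]].
    exists (t * a + (1 - t) * a'), (t * b + (1 - t) * b'),
      (t * c + (1 - t) * c').
    split; [nra|nra|nra| |by apply: pointP; rewrite !coordE; ring].
    have -> : c = 1 - a - b by lra.
    have -> : c' = 1 - a' - b' by lra.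
    by ring.
  move=> x [[->|->]|->].
  + by exists 1, 0, 0; split; rewrite ?ler01//; [ring|rewrite scale1r !scale0r !addr0].
  + by exists 0, 1, 0; split; rewrite ?ler01//; [ring|rewrite scale1r !scale0r add0r addr0].
  + by exists 0, 0, 1; split; rewrite ?ler01//; [ring|rewrite scale1r !scale0r !add0r].
- move=> _ [a [b [c [a0 b0 c0 abc ->]]]].
  have SA : hull [set A; B; C] A by apply: sub_hull; left; left.
  have SB : hull [set A; B; C] B by apply: sub_hull; left; right.
  have SC : hull [set A; B; C] C by apply: sub_hull; right.
  have [ab0|ab0] := eqVneq (a + b) 0.
    have -> : a = 0 by lra.
    have -> : b = 0 by lra.
    have -> : c = 1 by lra.
    by rewrite scale1r !scale0r !add0r.
  have abp : 0 < a + b by lra.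
  have SAB : hull [set A; B; C]
      ((a / (a + b)) *: A + (1 - a / (a + b)) *: B).
    by apply: hull_conv => //; rewrite ?divr_ge0// ?ler_pdivrMr//; lra.
  have -> : a *: A + b *: B + c *: C = (a + b) *:
     ((a / (a + b)) *: A + (1 - a / (a + b)) *: B) + (1 - (a + b)) *: C.
    have -> : c = 1 - (a + b) by lra.
    by apply: pointP; rewrite !coordE; field; lra.
  by apply: hull_conv => //; lra.
Qed.

Lemma hull2E A B : hull [set A; B] = simplex A B B.
Proof. by rewrite -hull3E -setUA setUid. Qed.

Lemma linear_formD a b x y :
  linear_form a b (x + y) = linear_form a b x + linear_form a b y.
Proof. by rewrite /linear_form !coordE; ring. Qed.

Lemma linear_formB a b x y :
  linear_form a b (x - y) = linear_form a b x - linear_form a b y.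
Proof. by rewrite /linear_form !coordE; ring. Qed.

Lemma linear_formZ a b t x : linear_form a b (t *: x) = t * linear_form a b x.
Proof. by rewrite /linear_form !coordE; ring. Qed.

Lemma translNP S A x : translN S A x <-> S (x + A).
Proof.
split=> [[y Sy <-]|Sx]; first by rewrite subrK.
by exists (x + A) => //; rewrite addrK.
Qed.

Lemma dilate_convex n S : @convex_set R (R * R)%type S ->
  @convex_set R (R * R)%type (dilate n S).
Proof.
move=> /convexP cS; apply/convexP => _ _ t t0 t1 [x Sx <-] [y Sy <-].
exists (t *: x + (1 - t) *: y); first exact: cS.
by apply: pointP; rewrite !coordE; ring.
Qed.

(** By convexity, [m u + n v] is [m + n] times the mean of [u] and [v] with weights proportional to
    [m] and [n]. *)
Lemma dilateD m n S x y : @convex_set R (R * R)%type S ->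
  dilate m S x -> dilate n S y -> dilate (m + n) S (x + y).
Proof.
move=> /convexP cS [u Su <-] [v Sv <-].
have [mn0|mn0] := eqVneq (m + n)%N 0%N.
  move/eqP : mn0; rewrite addn_eq0 => /andP[/eqP-> /eqP->].
  by exists u => //; rewrite !scale0r addr0.
have mnR : 0 < m%:R + n%:R :> R by rewrite -natrD ltr0n lt0n.
have m0 : 0 <= m%:R :> R by [].
have n0 : 0 <= n%:R :> R by [].
exists ((m%:R / (m%:R + n%:R)) *: u + (1 - m%:R / (m%:R + n%:R)) *: v).
  by apply: cS => //; rewrite ?divr_ge0 ?ler_pdivrMr ?mul1r ?lerDl// ltW.
by apply: pointP; rewrite !coordE natrD; field; lra.
Qed.

Lemma dilate_form_le n S a b c x : (forall y, S y -> linear_form a b y <= c) ->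
  dilate n S x -> linear_form a b x <= n%:R * c.
Proof.
by move=> Sc [y Sy <-]; rewrite linear_formZ ler_wpM2l// Sc.
Qed.

(** A maximum over the finite set exists, since [r0] makes it nonempty; the half-plane below this
    maximum is convex, so it contains the hull. *)
Lemma seq_form_max (s : seq (int * int)) (r0 : int * int) (a b : R) :
  r0 \in s -> exists2 r, r \in s &
    forall x, hull (lattice_pt @` [set` s]) x ->
      linear_form a b x <= linear_form a b (lattice_pt r).
Proof.
move=> r0s.
have [r rs rmax] : exists2 r, r \in s & forall u, u \in s ->
    linear_form a b (lattice_pt u) <= linear_form a b (lattice_pt r).
  elim: s r0 r0s => // r1 [_ _ _|r2 s IH r0 _].
    by exists r1; rewrite ?mem_head// => u; rewrite inE => /eqP ->.
  have [r rs rmax] := IH r2 (mem_head _ _).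
  have [h|h] := leP (linear_form a b (lattice_pt r1))
                    (linear_form a b (lattice_pt r)).
    exists r; first by rewrite inE rs orbT.
    by move=> u; rewrite inE => /orP[/eqP ->//|/rmax].
  exists r1; first by rewrite mem_head.
  move=> u; rewrite inE => /orP[/eqP ->//|/rmax ru].
  exact: le_trans ru (ltW h).
exists r => //; apply: hull_sub; first exact: convex_halfplane.
by move=> _ [u us <-] /=; exact: rmax.
Qed.

(** For fixed [A] and [B] the determinant is a scaled signed height over the line [A B], affine in
    [C]; points of extremal height thus come from [seq_form_max]. *)
Lemma orient_form A B C : orient A B C =
  linear_form (A.2 - B.2) (B.1 - A.1) C - linear_form (A.2 - B.2) (B.1 - A.1) A.
Proof. by rewrite /orient /linear_form; ring. Qed.

End Plane.

(** * Regular sequences of two monomials *)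

Section RegularSequences.
Context {k : fieldType} {R : realType}.
Variables (I : set nat) (S : nat -> set (R * R)).
Implicit Types (P Q u v : int * int) (F G : nat -> int * int -> k).

Let M : set (nat -> int * int -> k) := direct_sum I S.

Lemma direct_sum0 : M (0 : nat -> int * int -> k).
Proof.
split=> //.
- by rewrite (_ : [set _ | _] = set0)//; apply/seteqP; split => // i /=; rewrite eqxx.
- move=> i _; split; last by move=> u; rewrite eqxx.
  by rewrite (_ : [set _ | _] = set0)//; apply/seteqP; split => // u /=; rewrite eqxx.
Qed.

Lemma direct_sumB F G : M F -> M G -> M (F - G).
Proof.
move=> [fF sF zF] [fG sG zG]; split.
- apply: (@sub_finite_set _ _ ([set i | F i != 0] `|` [set i | G i != 0])).
    move=> i /=; rewrite (_ : (F - G) i = F i - G i)//.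
    have [->|] := eqVneq (F i) 0; last by left.
    by have [->|] := eqVneq (G i) 0; [rewrite subr0 eqxx|right].
  by rewrite finite_setU.
- move=> i Ii; have [fFi sFi] := sF i Ii; have [fGi sGi] := sG i Ii.
  have sub : [set u | (F - G) i u != 0] `<=`
      [set u | F i u != 0] `|` [set u | G i u != 0].
    move=> u /=; rewrite (_ : (F - G) i u = F i u - G i u)//; have [->|] := eqVneq (F i u) 0; last by left.
    by have [->|] := eqVneq (G i u) 0; [rewrite subr0 eqxx|right].
  split; first by apply: sub_finite_set sub _; rewrite finite_setU.
  by move=> u /sub[]; [exact: sFi|exact: sGi].
- by move=> i nIi; rewrite (_ : (F - G) i = F i - G i)// zF// zG// subr0.
Qed.

Lemma direct_sum_support F i u : M F -> F i u != 0 -> S i (lattice_pt u).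
Proof.
move=> [_ sF zF] Fiu; have [Ii|nIi] := pselect (I i).
  by have [_] := sF i Ii; apply.
by move: Fiu; rewrite zF// eqxx.
Qed.

Definition monomial (n : nat) u : nat -> int * int -> k :=
  fun i v => ((i == n) && (v == u))%:R.

Lemma monomial_direct_sum n u : I n -> S n (lattice_pt u) -> M (monomial n u).
Proof.
move=> In Snu.
have mE i v : monomial n u i v != 0 -> i = n /\ v = u.
  rewrite /monomial; have [->|] := eqVneq i n; last by rewrite eqxx.
  by have [->|] := eqVneq v u; last by rewrite eqxx.
split.
- apply: (@sub_finite_set _ _ [set n]) => // i /= /eqP Hi.
  apply: contrapT => ni; apply: Hi; apply/funext => v.
  by apply/eqP; apply: contrapT => /negP/mE[].
- move=> i _; split; last by move=> v /mE[-> ->].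
  by apply: (@sub_finite_set _ _ [set u]) => // v /mE[].
- move=> i nIi; apply/funext => v; apply/eqP; apply: contrapT => /negP/mE[ini _].
  by apply: nIi; rewrite ini.
Qed.

Lemma actXB P F G : actX P (F - G) = actX P F - actX P G.
Proof.
by apply/funext => -[|i]; apply/funext => u //; exact/esym/subr0.
Qed.

Lemma image_sum1 N P F :
  image_sum N [:: P] F <-> exists2 G, N G & F = actX P G.
Proof.
split=> [[G NG <-]|[G NG ->]].
  by exists (G ord0) => //; rewrite big_ord1.
by exists (fun=> G) => //; rewrite big_ord1.
Qed.

Lemma image_sum0 N F : image_sum N [::] F <-> F = 0.
Proof.
split=> [[G _ <-]|->]; first by rewrite big_ord0.
by exists (fun=> 0) => [[]//|]; rewrite big_ord0.
Qed.

Hypothesis Ipos : forall n, (0 < n)%N -> I n.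
Hypothesis Sempty : forall i u, ~ I i -> ~ S i (lattice_pt u).
Hypothesis S0 : forall u v, S 0 (lattice_pt u) -> S 0 (lattice_pt v) -> u = v.

(** Comparing coefficients shows that [X_P] is always injective, so only the second step has
    content. The section hypotheses cover both modules: all degrees, or the positive ones. *)
Lemma regular_sequence2P P Q : P != Q ->
  regular_sequence M [:: P; Q] <->
  forall n u, (0 < n)%N -> S n (lattice_pt (u + P)) ->
    S n (lattice_pt (u + Q)) -> S n.-1 (lattice_pt u).
Proof.
move=> PQ; split=> [reg n u n0 SP SQ|H].
  (* [X_Q] times the monomial at [u + P] equals [X_P] times the monomial at [u + Q]. Regularity then
     makes the former divisible by [X_P], with a quotient supported at [u] in degree [n - 1]. *)
  have MF := monomial_direct_sum (Ipos n0) SP.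
  have MG := monomial_direct_sum (Ipos n0) SQ.
  have := reg 1%N isT _ _ MF direct_sum0; rewrite /= !image_sum1 !subr0 -actXB subr0.
  case.
    exists (monomial n (u + Q)) => //.
    apply/funext => -[//|i]; apply/funext => v; rewrite /= /mul_monomial /monomial.
    by rewrite !subr_eq addrAC.
  case: n n0 {SP SQ MF MG} => // n _ G MG /(congr1 (fun F => F n.+1 (u + P))) /=.
  rewrite /monomial /mul_monomial !eqxx addrK /= => G1.
  by apply: (direct_sum_support MG); rewrite -G1 oner_neq0.
case=> [_ F G MF MG /=|[_ F G MF MG /=|//]].
  rewrite !image_sum0 -actXB => F0; apply/funext => i; apply/funext => u.
  move/(congr1 (fun F => F i.+1 (u + P))) : F0.
  by rewrite /= /mul_monomial addrK.
rewrite -actXB !image_sum1 => -[G' MG' FG'].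
have MD := direct_sumB MF MG; move: {F G MF MG}(F - G) MD FG' => F MF FG.
have FGE i u : F i u = G' i (u + Q - P).
  move/(congr1 (fun F => F i.+1 (u + Q))) : FG.
  by rewrite /= /mul_monomial addrK.
(* Nothing of degree 0 is divisible by [X_P]. A nonzero coefficient here would put both [u] and
   [u + Q - P] in [S 0], which has at most one lattice point. *)
have F0 u : F 0%N u = 0.
  apply/eqP; apply: contrapT => /negP Fu.
  have := Fu; rewrite FGE => /(direct_sum_support MG').
  move=> /(S0 (direct_sum_support MF Fu)) /eqP.
  by rewrite -addrA -subr_eq0 opprD addrA subrr sub0r oppr_eq0 subr_eq0 eq_sym (negbTE PQ).
(* The quotient of [F] by [X_P]; the shift condition bounds its support. *)
pose G i u := F i.+1 (u + P).
have SG i u : G i u != 0 -> S i (lattice_pt u).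
  rewrite /G => Fi; apply: (H i.+1) => //; first exact: direct_sum_support Fi.
  apply: (direct_sum_support MG'); move: Fi; rewrite FGE.
  by rewrite addrAC addrK.
exists G.
  have [fF sF zF] := MF; split.
  - apply: (@sub_finite_set _ _ (predn @` [set i | F i != 0])).
      move=> i /= /eqP Gi; exists i.+1 => //=; apply/eqP => Fi.
      by apply: Gi; apply/funext => u; rewrite /G Fi.
    exact: finite_image.
  - move=> i Ii; split; last exact: SG.
    have [fFi _] := sF i.+1 (Ipos (ltn0Sn i)).
    apply: (@sub_finite_set _ _ ((fun u => u - P) @` [set u | F i.+1 u != 0])).
      by move=> u Gu; exists (u + P) => //; rewrite addrK.
    exact: finite_image.
  - move=> i nIi; apply/funext => u; apply/eqP; apply: contrapT => /negP/SG.
    exact: Sempty.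
apply/funext => -[|i]; apply/funext => u; first by rewrite F0.
by rewrite /= /mul_monomial /G subrK.
Qed.

End RegularSequences.

(** * Cutting the polygon along a diagonal *)

Section Orientation.
Context {R : realType}.
Implicit Types (A B C D x y z p q v : R * R) (S T Delta H : set (R * R)) (t : R).

Lemma orientD A B x y t : orient A B (t *: x + (1 - t) *: y) =
  t * orient A B x + (1 - t) * orient A B y.
Proof. by rewrite /orient !coordE; ring. Qed.

Lemma orient_swap A B C : orient B A C = - orient A B C.
Proof. by rewrite /orient; ring. Qed.

Lemma orient_rot A B C : orient B C A = orient A B C.
Proof. by rewrite /orient; ring. Qed.

Lemma orientl A B : orient A B A = 0.
Proof. by rewrite /orient; ring. Qed.

Lemma orientr A B : orient A B B = 0.
Proof. by rewrite /orient; ring. Qed.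

Lemma orient_hull_ge0 A B S : (forall x, S x -> 0 <= orient A B x) ->
  forall x, hull S x -> 0 <= orient A B x.
Proof.
move=> S0; apply: hull_sub => //; apply/convexP => x y t t0 t1 /= x0 y0.
by rewrite orientD addr_ge0// mulr_ge0// subr_ge0.
Qed.

(** Cramer's rule: barycentric coordinates are ratios of signed areas. *)
Lemma barycentric A B C x : orient A B C != 0 ->
  x = (orient B C x / orient A B C) *: A + (orient C A x / orient A B C) *: B
      + (orient A B x / orient A B C) *: C.
Proof.
by rewrite /orient => o; apply: pointP; rewrite !coordE; field.
Qed.

Lemma hull3P A B C x : 0 < orient A B C ->
  0 <= orient A B x -> 0 <= orient B C x -> 0 <= orient C A x ->
  hull [set A; B; C] x.
Proof.
move=> o ABx BCx CAx; rewrite hull3E.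
exists (orient B C x / orient A B C), (orient C A x / orient A B C),
  (orient A B x / orient A B C).
split; rewrite ?divr_ge0// ?ltW//; last by apply: barycentric; rewrite gt_eqF.
rewrite -!mulrDl (_ : orient B C x + _ + _ = orient A B C).
  by rewrite divff// gt_eqF.
by rewrite /orient; ring.
Qed.

Lemma dist_gt0 p q : p != q -> 0 < (q.1 - p.1) ^+ 2 + (q.2 - p.2) ^+ 2.
Proof.
move=> pq; rewrite lt0r paddr_eq0 ?sqr_ge0// addr_ge0 ?sqr_ge0// andbT.
rewrite !sqrf_eq0 !subr_eq0; apply: contra pq => /andP[/eqP e1 /eqP e2].
exact/eqP/pointP.
Qed.

(** The squared length of [q - p] times [orient A B C] is a combination of differences of heights
    over the line [p q], so it vanishes if all heights do. *)
Lemma two_dimensional_off_line p q Delta : p != q -> two_dimensional Delta ->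
  exists2 x, Delta x & orient p q x != 0.
Proof.
move=> pq [A [B [C [DA DB DC /negP oN]]]]; apply: contrapT => noff.
have on x : Delta x -> orient p q x = 0.
  by move=> Dx; apply/eqP; apply: contrapT => /negP ox; apply: noff; exists x.
have := on A DA; have := on B DB; have := on C DC => oC oB oA.
have := dist_gt0 pq => d0.
apply/oN/eqP; apply: (mulfI (lt0r_neq0 d0)); rewrite mulr0.
have -> : ((q.1 - p.1) ^+ 2 + (q.2 - p.2) ^+ 2) * orient A B C =
  (q.1 - p.1) * ((B.1 - A.1) * (orient p q C - orient p q A)
                 - (C.1 - A.1) * (orient p q B - orient p q A)) +
  (q.2 - p.2) * ((B.2 - A.2) * (orient p q C - orient p q A)
                 - (C.2 - A.2) * (orient p q B - orient p q A)).
  by rewrite /orient; ring.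
by rewrite oA oB oC; ring.
Qed.

Lemma lineE p q : p != q -> line p q = [set v | orient p q v = 0].
Proof.
move=> /dist_gt0 d0; apply/seteqP; split=> [_ [t _ <-]|v /=].
  by rewrite /= /orient !coordE; ring.
rewrite /orient => ov.
(* [s / d] is the parameter of the orthogonal projection of [v] to the line. *)
pose d := (q.1 - p.1) ^+ 2 + (q.2 - p.2) ^+ 2.
pose s := (v.1 - p.1) * (q.1 - p.1) + (v.2 - p.2) * (q.2 - p.2).
have dN0 : d != 0 by rewrite gt_eqF.
have e1 : s * (q.1 - p.1) = (v.1 - p.1) * d.
  apply/eqP; rewrite -subr_eq0; apply/eqP.
  by transitivity ((q.2 - p.2) * (0 : R)); [rewrite -ov /s /d; ring|rewrite mulr0].
have e2 : s * (q.2 - p.2) = (v.2 - p.2) * d.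
  apply/eqP; rewrite -subr_eq0; apply/eqP.
  by transitivity ((p.1 - q.1) * (0 : R)); [rewrite -ov /s /d; ring|rewrite mulr0].
exists (s / d) => //; apply: pointP; rewrite !coordE mulrAC ?e1 ?e2 mulfK//;
  exact: subrKC.
Qed.

Lemma halfplane_orient p q : p != q ->
  halfplane_bordered_by (line p q) [set v | 0 <= orient p q v].
Proof.
move=> pq; rewrite lineE//.
exists (p.2 - q.2), (q.1 - p.1),
  (linear_form (p.2 - q.2) (q.1 - p.1) p); split.
- apply: contra pq => /eqP[e1 e2]; apply/eqP/pointP; lra.
- by apply/seteqP; split=> v /=; rewrite orient_form /linear_form => h; lra.
- by apply/seteqP; split=> v /=; rewrite orient_form /linear_form => h; lra.
Qed.

Lemma line_sym p q : p != q -> line p q = line q p.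
Proof.
move=> pq; rewrite !lineE// 1?eq_sym//; apply/seteqP.
by split=> v /= h; rewrite orient_swap h oppr0.
Qed.

(** The vector [(a, b)] is orthogonal to [q - p], so the two affine forms are proportional and the
    sign of [e] selects the half-plane. By Lagrange's identity [e = 0] would force
    [(a, b) = (0, 0)]. *)
Lemma halfplane_borderedE p q H : p != q ->
  halfplane_bordered_by (line p q) H ->
  H = [set v | 0 <= orient p q v] \/ H = [set v | 0 <= orient q p v].
Proof.
move=> pq [a [b [c [ab lE ->]]]].
have lp : line p q p by rewrite lineE//= orientl.
have lq : line p q q by rewrite lineE//= orientr.
rewrite lE /= in lp; rewrite lE /= in lq.
pose d := (q.1 - p.1) ^+ 2 + (q.2 - p.2) ^+ 2.
pose e := b * (q.1 - p.1) - a * (q.2 - p.2).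
have d0 : 0 < d by exact: dist_gt0.
have dE v : d * (a * v.1 + b * v.2 - c) = e * orient p q v.
  have h : a * (q.1 - p.1) + b * (q.2 - p.2) = 0 by lra.
  rewrite -lp /d /e /orient.
  transitivity ((b * (q.1 - p.1) - a * (q.2 - p.2)) *
    ((q.1 - p.1) * (v.2 - p.2) - (q.2 - p.2) * (v.1 - p.1)) +
    (a * (q.1 - p.1) + b * (q.2 - p.2)) *
    ((v.1 - p.1) * (q.1 - p.1) + (v.2 - p.2) * (q.2 - p.2))); first by ring.
  by rewrite h; ring.
have HE v : (c <= a * v.1 + b * v.2) = (0 <= e * orient p q v).
  by rewrite -dE pmulr_rge0// subr_ge0.
have [e0|e0|e0] := ltgtP 0 e.
- left; apply/seteqP; split=> v /=; by rewrite HE pmulr_rge0.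
- right; apply/seteqP; split=> v /=; by rewrite HE nmulr_rge0// (orient_swap p q) oppr_ge0.
- have : (a ^+ 2 + b ^+ 2) * d = 0.
    have h : a * (q.1 - p.1) + b * (q.2 - p.2) = 0 by lra.
    transitivity (e ^+ 2 + (a * (q.1 - p.1) + b * (q.2 - p.2)) ^+ 2).
      by rewrite /d /e; ring.
    by rewrite -e0 h; ring.
  move/eqP; rewrite mulf_eq0 (gt_eqF d0) orbF paddr_eq0 ?sqr_ge0// !sqrf_eq0.
  by move=> /andP[/eqP a0 /eqP b0]; move: ab; rewrite a0 b0 eqxx.
Qed.

Lemma triangle_sym p q A S : triangle p q A S -> triangle q p A S.
Proof.
by case=> o ->; split; [rewrite orient_swap oppr_eq0|rewrite (setUC [set p])].
Qed.

(** Condition (8) for the half-plane to the left of [p q]; exchanging [p] and [q] gives the other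
    one. *)
Definition half_triangle p q Delta : Prop :=
  (exists A, triangle p q A ([set v | 0 <= orient p q v] `&` Delta)) \/
  [set v | 0 <= orient p q v] `&` Delta = hull [set p; q].

Definition diagonal p q Delta : Prop :=
  (exists A B, quadrangle p A q B Delta) \/ (exists A, triangle p q A Delta).

Lemma diagonal_sym p q Delta : diagonal p q Delta -> diagonal q p Delta.
Proof.
case=> [[A [B [u [o1 o2] [o3 o4] ->]]]|[A T]]; [left|right].
  exists B, A; split=> //.
    have -> : [:: q; B; p; A] = rot 2 [:: p; A; q; B] by [].
    by rewrite rot_uniq.
  congr hull; apply/seteqP.
  split=> x /=; rewrite -?orA; tauto.
by exists A; exact: triangle_sym.
Qed.

(** The height of a point over [p q] is its [A]-coordinate times the negative height of [A], so this
    coordinate must vanish. *)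
Lemma segment_upper p q A : orient p q A < 0 ->
  [set v | 0 <= orient p q v] `&` hull [set p; A; q] = hull [set p; q].
Proof.
move=> A0; apply/seteqP; split.
  move=> x [/= x0]; rewrite hull3E hull2E => -[a [b [c [a0 b0 c0 abc xE]]]].
  have b00 : b = 0.
    have : orient p q x = b * orient p q A.
      rewrite xE /orient !coordE; have -> : a = 1 - b - c by lra.
      by ring.
    nra.
  exists a, c, 0; split=> //; first by lra.
  by rewrite xE b00 !scale0r !addr0.
move=> x xpq; split=> /=.
  by apply: (orient_hull_ge0 _ xpq) => y [->|->]; rewrite ?orientl ?orientr.
by apply: hullS xpq => y [->|->]; [left; left|right].
Qed.

Lemma diagonal_half_triangle p q Delta : p != q -> two_dimensional Delta ->
  diagonal p q Delta -> half_triangle p q Delta.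
Proof.
move=> pq dimD [[A [B [_ [o1 o2] [o3 o4] DE]]]|[A [oA DE]]].
- have A0 : orient p q A <= 0 by move: o1; rewrite /orient; lra.
  have B0 : 0 <= orient p q B by move: o3; rewrite /orient; lra.
  (* If [B] is strictly above [p q], the lines [q B] and [B p] support the quadrangle and bound its
     upper half. *)
  have [Bp|B0'] := ltP 0 (orient p q B).
    left; exists B; split; first by rewrite gt_eqF.
    rewrite DE; apply/seteqP; split.
      move=> x [/= x0 xD]; apply: hull3P => //.
        apply: (orient_hull_ge0 _ xD) => y [[[->|->]|->]|->].
        + by rewrite orient_rot.
        + by move: o2; rewrite -orient_rot.
        + by rewrite orientl.
        + by rewrite orientr.
      apply: (orient_hull_ge0 _ xD) => y [[[->|->]|->]|->].
      + by rewrite orientr.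
      + by [].
      + by rewrite -orient_rot.
      + by rewrite orientl.
    move=> x xT; split.
      apply: (orient_hull_ge0 _ xT) => y [[->|->]|->].
      + by rewrite orientl.
      + by rewrite orientr.
      + by rewrite ltW.
    by apply: hullS xT => y [[->|->]|->]; [left; left; left|left; right|right].
  (* Straight angle at [B]: two-dimensionality puts [A] strictly below [p q], and the angles at [q]
     and [p] keep [B] inside the triangle [p A q], which is then all of [Delta]. *)
  have {B0 B0'}B0 : orient p q B = 0 by apply/eqP; rewrite eq_le B0' B0.
  right.
  have Dle x : Delta x -> 0 <= orient q p x.
    rewrite DE; apply: orient_hull_ge0 => y [[[->|->]|->]|->].
    + by rewrite orientr.
    + by rewrite orient_swap oppr_ge0.
    + by rewrite orientl.
    + by rewrite orient_swap B0 oppr0.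
  have A0' : orient p q A < 0.
    rewrite lt_neqAle A0 andbT; apply/eqP => A00.
    have [x Dx] := two_dimensional_off_line pq dimD.
    rewrite eq_le; apply/negP; rewrite negbK; apply/andP; split.
      by have := Dle _ Dx; rewrite orient_swap oppr_ge0.
    move: Dx; rewrite DE; apply: orient_hull_ge0 => y [[[->|->]|->]|->];
      by rewrite ?orientl ?orientr ?A00 ?B0.
  suff -> : Delta = hull [set p; A; q] by exact: segment_upper.
  apply/seteqP; split=> x; last first.
    rewrite DE; apply: hullS => y [[->|->]|->].
    + by left; left; left.
    + by left; left; right.
    + by left; right.
  move=> Dx; apply: hull3P; last exact: Dle.
  + by move: A0'; rewrite /orient; lra.
  + move: Dx; rewrite DE; apply: orient_hull_ge0 => y [[[->|->]|->]|->] //.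
    * by rewrite orientl.
    * by rewrite orientr.
    * by rewrite orient_rot.
  + move: Dx; rewrite DE; apply: orient_hull_ge0 => y [[[->|->]|->]|->] //.
    * by rewrite orient_rot.
    * by rewrite orientl.
    * by rewrite orientr.
- have [A0|A0] := ltP 0 (orient p q A).
    left; exists A; split; first by rewrite gt_eqF.
    rewrite -DE; apply/setIidPr => x; rewrite DE /=.
    by apply: orient_hull_ge0 => y [[->|->]|->]; rewrite ?orientl ?orientr// ltW.
  right; rewrite DE.
  have -> : [set p; q; A] = [set p; A; q].
    by apply/seteqP; split=> x /=; tauto.
  by apply: segment_upper; rewrite lt_neqAle oA.
Qed.

(** Comparing [p]-coordinates in the two expressions gives [n a - 1 = n a']. Hence the point has
    coordinates [n a'], [n b], [n c], all nonnegative and of sum [n - 1]. When [A = q] only the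
    [p]-coordinate is determined, which is enough. *)
Lemma simplex_shift p q A n z1 z2 : p != q -> orient p q A != 0 \/ A = q ->
  (0 < n)%N -> simplex p q A z1 -> simplex p q A z2 ->
  n%:R *: z1 - p = n%:R *: z2 - q -> dilate n.-1 (simplex p q A) (n%:R *: z1 - p).
Proof.
move=> pq oA n0 [a [b [c [a0 b0 c0 abc z1E]]]] [a' [b' [c' [a'0 b'0 c'0 abc' z2E]]]] zE.
pose N : R := n%:R; rewrite -/N in zE *.
have e1 : (N * (b - b') + 1) * (q.1 - p.1) + N * (c - c') * (A.1 - p.1) = 0.
  move/(congr1 fst) : zE; rewrite !(add1E, opp1E, scale1E) z1E z2E.
  rewrite !(add1E, opp1E, scale1E).
  have -> : a = 1 - b - c by lra.
  have -> : a' = 1 - b' - c' by lra.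
  lra.
have e2 : (N * (b - b') + 1) * (q.2 - p.2) + N * (c - c') * (A.2 - p.2) = 0.
  move/(congr1 snd) : zE; rewrite !(add2E, opp2E, scale2E) z1E z2E.
  rewrite !(add2E, opp2E, scale2E).
  have -> : a = 1 - b - c by lra.
  have -> : a' = 1 - b' - c' by lra.
  lra.
have aE : N * a - 1 = N * a'.
  have -> : a = 1 - b - c by lra.
  have -> : a' = 1 - b' - c' by lra.
  case: oA => [oA|Aq].
    have eb : N * (b - b') + 1 = 0.
      apply: (mulIf oA); rewrite mul0r /orient.
      transitivity (((N * (b - b') + 1) * (q.1 - p.1) + N * (c - c') * (A.1 - p.1))
        * (A.2 - p.2) - ((N * (b - b') + 1) * (q.2 - p.2) +
        N * (c - c') * (A.2 - p.2)) * (A.1 - p.1)); first by ring.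
      by rewrite e1 e2; ring.
    have ec : N * (c - c') = 0.
      apply: (mulIf oA); rewrite mul0r /orient.
      transitivity (((N * (b - b') + 1) * (q.2 - p.2) + N * (c - c') * (A.2 - p.2))
        * (q.1 - p.1) - ((N * (b - b') + 1) * (q.1 - p.1) +
        N * (c - c') * (A.1 - p.1)) * (q.2 - p.2)); first by ring.
      by rewrite e1 e2; ring.
    lra.
  rewrite Aq in e1 e2.
  have d0 := dist_gt0 pq.
  suff : N * (b - b') + 1 + N * (c - c') = 0 by lra.
  apply: (mulIf (lt0r_neq0 d0)); rewrite mul0r.
  transitivity (((N * (b - b') + 1) * (q.1 - p.1) + N * (c - c') * (q.1 - p.1))
        * (q.1 - p.1) + ((N * (b - b') + 1) * (q.2 - p.2) +
        N * (c - c') * (q.2 - p.2)) * (q.2 - p.2)); first by ring.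
  by rewrite e1 e2; ring.
case: n @N n0 {zE e1 e2} aE => // n N _ aE /=.
have NE : N = n%:R + 1 by rewrite /N -natr1.
have N0 : 0 <= n%:R :> R by [].
have vE : N *: z1 - p = (N * a') *: p + (N * b) *: q + (N * c) *: A.
  by rewrite -aE z1E; apply: pointP; rewrite !coordE; ring.
have sE : N * a' + N * b + N * c = n%:R.
  rewrite -aE; have -> : a = 1 - b - c by lra.
  by rewrite NE; ring.
have Na' : 0 <= N * a' by apply: mulr_ge0.
have Nb : 0 <= N * b by apply: mulr_ge0.
have Nc : 0 <= N * c by apply: mulr_ge0.
(* Here [n] is the predecessor of the original one. If it is 0, the point is the origin, and any
   point of the simplex witnesses the 0-fold dilate. *)
have [n0|n0] := eqVneq n 0%N.
  exists z1; first by exists a, b, c.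
  rewrite vE; move: sE; rewrite n0 => sE.
  have -> : N * a' = 0 by lra.
  have -> : N * b = 0 by lra.
  have -> : N * c = 0 by lra.
  by rewrite !scale0r !addr0.
have nN0 : n%:R != 0 :> R by rewrite pnatr_eq0.
exists ((N * a' / n%:R) *: p + (N * b / n%:R) *: q + (N * c / n%:R) *: A).
  exists (N * a' / n%:R), (N * b / n%:R), (N * c / n%:R); split=> //.
  - exact: divr_ge0.
  - exact: divr_ge0.
  - exact: divr_ge0.
  - by rewrite -!mulrDl sE divff.
by rewrite vE !scalerDr !scalerA ![n%:R * _]mulrC !divfK.
Qed.

Lemma orient_shift p q n z1 z2 : (0 < n)%N ->
  n%:R *: z1 - p = n%:R *: z2 - q -> orient p q z1 = orient p q z2.
Proof.
rewrite -(ltr0n R) => n0 zE; have := congr1 fst zE; have := congr1 snd zE.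
rewrite !(add1E, opp1E, scale1E, add2E, opp2E, scale2E) => e2 e1.
have {}e1 : n%:R * (z2.1 - z1.1) = q.1 - p.1 by lra.
have {}e2 : n%:R * (z2.2 - z1.2) = q.2 - p.2 by lra.
apply/esym/eqP; rewrite -subr_eq0 -(mulrI_eq0 _ (mulfI (lt0r_neq0 n0))).
rewrite (_ : _ * _ = (q.1 - p.1) * (n%:R * (z2.2 - z1.2)) -
  (q.2 - p.2) * (n%:R * (z2.1 - z1.1))); last by rewrite /orient; ring.
by rewrite e1 e2 mulrC subrr.
Qed.

Lemma half_triangle_shift p q Delta n z1 z2 : p != q -> half_triangle p q Delta ->
  (0 < n)%N -> Delta z1 -> Delta z2 -> n%:R *: z1 - p = n%:R *: z2 - q ->
  0 <= orient p q z1 -> dilate n.-1 Delta (n%:R *: z1 - p).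
Proof.
move=> pq hT n0 Dz1 Dz2 zE z10.
have z20 : 0 <= orient p q z2 by rewrite -(orient_shift n0 zE).
have sub T : T = [set v | 0 <= orient p q v] `&` Delta ->
    forall m, dilate m T `<=` dilate m Delta.
  by move=> -> m _ [x [_ Dx] <-]; exists x.
case: hT => [[A [oA TE]]|TE].
  apply: (sub _ (esym TE)); rewrite hull3E; apply: simplex_shift zE => //.
  - by left.
  - by rewrite -hull3E -TE.
  - by rewrite -hull3E -TE.
apply: (sub _ (esym TE)); rewrite hull2E; apply: simplex_shift zE => //.
- by right.
- by rewrite -hull2E -TE.
- by rewrite -hull2E -TE.
Qed.

(** The points [z1] and [z2] differ by a multiple of [q - p], so they have the same height over
    [p q] and lie in a common half. *)
Lemma half_triangles_dilate p q Delta n : p != q ->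
  half_triangle p q Delta -> half_triangle q p Delta -> (0 < n)%N ->
  translN (dilate n Delta) p `&` translN (dilate n Delta) q
    `<=` dilate n.-1 Delta.
Proof.
move=> pq h1 h2 n0 v [/translNP[z1 Dz1 z1E] /translNP[z2 Dz2 z2E]].
have v1 : v = n%:R *: z1 - p by rewrite z1E addrK.
have v2 : v = n%:R *: z2 - q by rewrite z2E addrK.
have [z10|z10] := leP 0 (orient p q z1).
  by rewrite v1; apply: half_triangle_shift z10 => //; [exact: Dz2|rewrite -v1].
have zE : n%:R *: z2 - q = n%:R *: z1 - p by rewrite -v1.
rewrite v2; apply: half_triangle_shift (zE) _ => //; first by rewrite eq_sym.
by rewrite orient_swap -(orient_shift n0 (esym zE)) oppr_ge0 ltW.
Qed.

End Orientation.

(** * Interiors *)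

Section Interior.
Context {R : realType}.
Implicit Types (A B C x y z p q v : R * R) (S T Delta : set (R * R)).

Lemma interiorP S x : S° x <-> exists2 e : R, 0 < e &
  forall y, `|y.1 - x.1| < e -> `|y.2 - x.2| < e -> S y.
Proof.
rewrite /interior; split=> [/nbhs_ballP[e /= e0 Be]|[e e0 Be]].
  exists e => // y y1 y2; apply: Be; split; rewrite /ball /= distrC //.
by apply/nbhs_ballP; exists e => //= y [y1 y2]; apply: Be; rewrite distrC.
Qed.

Lemma interior_convex S : @convex_set R (R * R)%type S ->
  @convex_set R (R * R)%type S°.
Proof.
move=> /convexP cS; apply/convexP => x y t t0 t1.
move=> /interiorP[e e0 xe] /interiorP[f f0 yf].
apply/interiorP; exists (Num.min e f) => [|z]; first by rewrite lt_min e0.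
rewrite !lt_min => /andP[z1e z1f] /andP[z2e z2f].
pose d := z - (t *: x + (1 - t) *: y).
have -> : z = t *: (x + d) + (1 - t) *: (y + d).
  by apply: pointP; rewrite /d !coordE; ring.
apply: cS => //; [apply: xe|apply: yf].
all: by rewrite !(add1E, add2E) [in X in `|X|]addrAC subrr add0r.
Qed.

Lemma interior_shift S T y : (forall x, S x -> T (x + y)) ->
  forall x, S° x -> T° (x + y).
Proof.
move=> ST x /interiorP[e e0 xe]; apply/interiorP; exists e => // z z1 z2.
rewrite -(subrK y z); apply: ST; apply: xe; rewrite !coordE.
- by move: z1; rewrite !coordE opprD addrA addrAC.
- by move: z2; rewrite !coordE opprD addrA addrAC.
Qed.

Lemma interior_dilateD m n S x y : @convex_set R (R * R)%type S ->
  (dilate m S)° x -> dilate n S y -> (dilate (m + n) S)° (x + y).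
Proof.
move=> cS mx ny; apply: interior_shift mx => z mz; exact: dilateD.
Qed.

Lemma interior_translN S T p q :
  translN S p `&` translN S q `<=` T ->
  translN S° p `&` translN S° q `<=` T°.
Proof.
move=> ST v [/translNP/interiorP[e e0 pe] /translNP/interiorP[f f0 qf]].
apply/interiorP; exists (Num.min e f) => [|z]; first by rewrite lt_min e0.
rewrite !lt_min => /andP[z1e z1f] /andP[z2e z2f].
have shift (a b c : R) : b + a - (c + a) = b - c by ring.
apply: ST; split; apply/translNP; [apply: pe|apply: qf];
  by rewrite !coordE shift.
Qed.

(** The interior of a convex set is convex, so taking the hull adds no lattice points. This reduces
    (2) and (6) to interiors. *)
Lemma inner_hullE S u : @convex_set R (R * R)%type S ->
  inner_hull S (lattice_pt u) <-> S° (lattice_pt u).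
Proof.
move=> cS; split=> [|Su]; last by apply: sub_hull; split=> //; exists u.
by apply: hull_sub => [|_ []//]; exact: interior_convex.
Qed.

(** At a third of [A + B + C] each of the three edge determinants is a third of [orient A B C], and
    a small perturbation keeps them nonnegative. With lattice points this supplies the fixed
    translation into the interior. *)
Lemma barycenter_interior S A B C : @convex_set R (R * R)%type S ->
  orient A B C != 0 -> S A -> S B -> S C -> (dilate 3 S)° (A + B + C).
Proof.
move=> cS; wlog o : A B C / 0 < orient A B C.
  move=> wl o SA SB SC; have [o'|o'|o'] := ltgtP 0 (orient A B C).
  - exact: wl.
  - rewrite (addrC A); apply: wl => //; first by rewrite orient_swap oppr_gt0.
    by rewrite orient_swap oppr_eq0.
  - by rewrite o' eqxx in o.
move=> _ SA SB SC.
(* [K] bounds the coefficients of all three edge forms; the summand 1 makes it positive. *)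
pose K : R := `|B.2 - A.2| + `|B.1 - A.1| + `|C.2 - B.2| + `|C.1 - B.1|
  + `|A.2 - C.2| + `|A.1 - C.1| + 1.
have K1 : 1 <= K by rewrite /K lerDr !addr_ge0.
have K0 : 0 < K by exact: lt_le_trans K1.
apply/interiorP; exists (orient A B C / K) => [|z]; first exact: divr_gt0.
rewrite !ltr_pdivlMr// => z1 z2.
exists (3^-1 *: z); last by rewrite scalerA divff ?scale1r.
have sub : hull [set A; B; C] `<=` S.
  by apply: hull_sub => // x [[->|->]|->].
set d1 := z.1 - _ in z1; set d2 := z.2 - _ in z2.
have z1E : z.1 = A.1 + B.1 + C.1 + d1 by rewrite /d1 !coordE; ring.
have z2E : z.2 = A.2 + B.2 + C.2 + d2 by rewrite /d2 !coordE; ring.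
have bound (a b : R) : `|a| + `|b| <= K -> 0 <= orient A B C + (b * d2 - a * d1).
  move=> abK.
  have : `|b * d2 - a * d1| <= orient A B C.
    apply: (le_trans (ler_normB _ _)); rewrite !normrM.
    have [d|d] := leP `|d1| `|d2|.
    - apply: le_trans (ltW z2); rewrite [leRHS]mulrC.
      apply: le_trans (ler_wpM2r (normr_ge0 d2) abK); rewrite mulrDl addrC lerD2r.
      exact: ler_wpM2l.
    - apply: le_trans (ltW z1); rewrite [leRHS]mulrC.
      apply: le_trans (ler_wpM2r (normr_ge0 d1) abK); rewrite mulrDl addrC lerD2l.
      exact/ler_wpM2l/ltW.
  by rewrite ler_norml => /andP[]; lra.
have n0 (a : R) : 0 <= `|a| by [].
have := n0 (B.2 - A.2); have := n0 (B.1 - A.1); have := n0 (C.2 - B.2).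
have := n0 (C.1 - B.1); have := n0 (A.2 - C.2); have := n0 (A.1 - C.1).
move=> h1 h2 h3 h4 h5 h6.
have third_ge0 : 0 <= 3^-1 :> R by [].
apply: sub; apply: hull3P => //.
- rewrite (_ : orient A B _ = 3^-1 * (orient A B C +
    ((B.1 - A.1) * d2 - (B.2 - A.2) * d1))).
    by apply/mulr_ge0/bound => //; rewrite /K; lra.
  by rewrite /orient !coordE z1E z2E; field.
- rewrite (_ : orient B C _ = 3^-1 * (orient A B C +
    ((C.1 - B.1) * d2 - (C.2 - B.2) * d1))).
    by apply/mulr_ge0/bound => //; rewrite /K; lra.
  by rewrite /orient !coordE z1E z2E; field.
- rewrite (_ : orient C A _ = 3^-1 * (orient A B C +
    ((A.1 - C.1) * d2 - (A.2 - C.2) * d1))).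
    by apply/mulr_ge0/bound => //; rewrite /K; lra.
  by rewrite /orient !coordE z1E z2E; field.
Qed.

End Interior.

(** * Shift conditions and extremal points *)

Section LatticeGeometry.
Context {R : realType}.
Implicit Types (A B C x y z p q v r : R * R) (S T : set (R * R)) (u P Q : int * int).

Lemma lattice_ptD u P : lattice_pt (u + P) = lattice_pt u + lattice_pt P :> R * R.
Proof. by apply: pointP; rewrite /lattice_pt /= intrD. Qed.

Lemma lattice_ptB u P : lattice_pt (u - P) = lattice_pt u - lattice_pt P :> R * R.
Proof. by apply: pointP; rewrite /lattice_pt /= intrB. Qed.

Lemma lattice_ptMn u n : lattice_pt (u *+ n) = n%:R *: lattice_pt u :> R * R.
Proof.
elim: n => [|n IH]; first by rewrite mulr0n scale0r.
by rewrite mulrSr lattice_ptD IH -natr1 scalerDl scale1r.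
Qed.

Lemma lattice_pt_inj : injective (@lattice_pt R).
Proof.
move=> [a b] [c d] [] /eqP; rewrite eqr_int => /eqP-> /eqP.
by rewrite eqr_int => /eqP->.
Qed.

(** Integral heights make the intersection of a lattice segment with [p q] rational, as [no_retreat]
    requires. *)
Lemma orient_lattice_nat P Q u :
  0 <= orient (lattice_pt P) (lattice_pt Q) (lattice_pt u) :> R ->
  exists n : nat, orient (lattice_pt P) (lattice_pt Q) (lattice_pt u) = n%:R :> R.
Proof.
rewrite /orient /= -!intrB -!intrM -intrB ler0z; set d := (_ - _ * _)%R => d0.
by exists `|d|%N; rewrite -{1}(gez0_abs d0).
Qed.

(** The common shape of (6) and (7) and, through [regular_sequence2P], of (1) and (2). *)
Definition lattice_shift (S : nat -> set (R * R)) P Q : Prop :=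
  forall n u, (0 < n)%N -> S n (lattice_pt (u + P)) ->
    S n (lattice_pt (u + Q)) -> S n.-1 (lattice_pt u).

Lemma lattice_shiftP (S : nat -> set (R * R)) P Q :
  (forall n : nat, (1 <= n)%N ->
    translN (S n) (lattice_pt P) `&` translN (S n) (lattice_pt Q) `&` Zlattice
      `<=` S n.-1 `&` Zlattice) <-> lattice_shift S P Q.
Proof.
split=> [H n u n0 SP SQ|H n n1 v [[/translNP SP /translNP SQ] [u _ uE]]].
  have [] // := H n n0 (lattice_pt u); split; last by exists u.
  by split; apply/translNP; rewrite -lattice_ptD.
split; last by exists u.
by rewrite -uE; apply: (H n) => //; rewrite lattice_ptD uE.
Qed.

(* The conditions on N and u say that r is rational: besides vertices, r has to
   be allowed to be the point where a segment between vertices meets the line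
   through p and q. *)
Definition no_retreat p q S : Prop :=
  forall (a b w : R) r (N : nat) u, S r -> (0 < N)%N ->
    N%:R *: r = lattice_pt u ->
    (forall x, S x -> linear_form a b x <= linear_form a b r) ->
    linear_form a b q < linear_form a b r ->
    0 < w -> ~ S (r - w *: (q - p)).

Lemma retreat_le S p q r (v w : R) : @convex_set R (R * R)%type S -> S r ->
  S (r - w *: (q - p)) -> 0 <= v -> v <= w -> S (r - v *: (q - p)).
Proof.
move=> /convexP cS Sr Sw v0 vw.
have [w0|w0] := eqVneq w 0.
  by have -> : v = w by lra.
have wp : 0 < w by lra.
have -> : r - v *: (q - p) =
    (v / w) *: (r - w *: (q - p)) + (1 - v / w) *: r.
  by apply: pointP; rewrite !coordE; field.
by apply: cS => //; [rewrite divr_ge0// ltW|rewrite ler_pdivrMr// mul1r].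
Qed.

Lemma exists_inv_lt (w : R) : 0 < w -> exists2 K : nat, (0 < K)%N & K%:R^-1 <= w.
Proof.
move=> w0; have wV : 0 < w^-1 by rewrite invr_gt0.
have bound := archi_boundP (ltW wV); have b0 := lt_trans wV bound.
by exists (Num.bound w^-1); [rewrite -(ltr0n R)|rewrite invf_ple ?posrE ?ltW].
Qed.

(** Take [n = N K], so that [n r] is a lattice point and the retreat [1 / n] is at most [w]. The
    shift condition then puts [n r - q] in the dilate by [n - 1], where the form is too large. *)
Lemma no_retreat_dilate S P Q : @convex_set R (R * R)%type S ->
  lattice_shift (fun n => dilate n S) P Q ->
  no_retreat (lattice_pt P) (lattice_pt Q) S.
Proof.
move=> cS sh a b w r N u Sr N0 Nr rmax qr w0 Sw.
have [K K0 Kw] := exists_inv_lt w0.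
have n0 : (0 < N * K)%N by rewrite muln_gt0 N0.
have nR : 0 < (N * K)%:R :> R by rewrite ltr0n.
have rE : (N * K)%:R *: r = lattice_pt (u *+ K).
  by rewrite lattice_ptMn -Nr scalerA natrM mulrC.
have : dilate (N * K).-1 S (lattice_pt (u *+ K - Q)).
  apply: sh => //; last by rewrite subrK -rE; exists r.
  exists (r - (N * K)%:R^-1 *: (lattice_pt Q - lattice_pt P)).
    apply: retreat_le Sw _ _ => //.
    apply: le_trans Kw; rewrite lef_pV2 ?posrE ?ltr0n// ler_nat.
    exact: leq_pmull.
  rewrite scalerBr scalerA divff ?gt_eqF// scale1r rE lattice_ptD lattice_ptB.
  by rewrite opprB addrA addrAC.
move=> /(dilate_form_le rmax); rewrite lattice_ptB -rE linear_formB linear_formZ.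
by rewrite -[in X in X%:R * _ - _](prednK n0) -natr1; lra.
Qed.

Lemma no_retreat_real S p q n : @convex_set R (R * R)%type S -> S p -> S q ->
  (1 < n)%N ->
  translN (dilate n S) p `&` translN (dilate n S) q `<=` dilate n.-1 S ->
  no_retreat p q S.
Proof.
move=> cS Sp Sq n1 sh a b w0 r _ _ Sr _ _ rmax qr w00 Sw0.
pose w := Num.min w0 1.
have wp : 0 < w by rewrite lt_min w00 ltr01.
have w1 : w <= 1 by rewrite ge_min lexx orbT.
have Sw : S (r - w *: (q - p)).
  by apply: retreat_le Sw0 (ltW wp) _ => //; rewrite ge_min lexx.
have n2 : 2 <= n%:R :> R by rewrite (ler_nat R 2 n).
have np : 0 < n%:R :> R by lra.
pose i : R := n%:R^-1.
have i0 : 0 < i by rewrite invr_gt0.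
have ni : n%:R * i = 1 by rewrite divff// gt_eqF.
have i2 : i <= 2^-1 by rewrite lef_pV2 ?posrE.
(* The trapezoid p, q, r, r - w (q - p) is at least (q - p) / n wide at s, and
   the homothety with centre q and ratio n / (n - 1) takes s beyond r. *)
pose s := (1 - i * (1 - w)) *: r + (1 - (1 - i * (1 - w))) *: q.
have /convexP cS' := cS.
have c0 : 0 <= 1 - i * (1 - w) by nra.
have c1 : 1 - i * (1 - w) <= 1 by nra.
have Ss : S s by exact: cS'.
have Ssi : S (s - i *: (q - p)).
  (* The available width exceeds [i] by [w (1 - 2 i + i w)], which is nonnegative because [n] is at
     least 2. *)
  apply: (@retreat_le _ p q s i ((1 - i * (1 - w)) * w + i * (1 - w))) => //.
  - have -> : s - ((1 - i * (1 - w)) * w + i * (1 - w)) *: (q - p) =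
      (1 - i * (1 - w)) *: (r - w *: (q - p)) + (1 - (1 - i * (1 - w))) *: p.
      by apply: pointP; rewrite /s !coordE; ring.
    exact: cS'.
  - exact: ltW.
  - nra.
have : dilate n.-1 S (n%:R *: s - q).
  apply: sh; split; apply/translNP; last by rewrite subrK; exists s.
  exists (s - i *: (q - p)) => //.
  by rewrite scalerBr scalerA ni scale1r opprB addrA addrAC.
move=> /(dilate_form_le rmax).
have -> : n.-1%:R = n%:R - 1 :> R by rewrite -subn1 natrB// ltnW.
rewrite linear_formB linear_formZ /s linear_formD !linear_formZ.
set L := linear_form a b q in qr *; set M := linear_form a b r in qr *.
have -> : n%:R * ((1 - i * (1 - w)) * M + (1 - (1 - i * (1 - w))) * L) - L =
  n%:R * M - (n%:R * i) * (1 - w) * (M - L) - L by ring.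
(* The value equals [(n - 1) M + w (M - L)], above the bound [(n - 1) M]. *)
by rewrite ni mul1r; nra.
Qed.

Lemma no_retreat_interior S P Q X : @convex_set R (R * R)%type S ->
  S (lattice_pt P) -> S (lattice_pt Q) -> S (lattice_pt X) ->
  orient (lattice_pt P) (lattice_pt Q) (lattice_pt X) != 0 :> R ->
  lattice_shift (fun n => (dilate n S)°) P Q ->
  no_retreat (lattice_pt P) (lattice_pt Q) S.
Proof.
move=> cS SP SQ SX oX sh a b w r N u Sr N0 Nr rmax qr w0 Sw.
have [K K0 Kw] := exists_inv_lt w0.
have n0 : (0 < N * K)%N by rewrite muln_gt0 N0.
have nR : 0 < (N * K)%:R :> R by rewrite ltr0n.
pose c := P + Q + X.
have rE M : (N * M)%:R *: r = lattice_pt (u *+ M).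
  by rewrite lattice_ptMn -Nr scalerA natrM mulrC.
(* Iterating the shift condition subtracts q as often as we like, at the cost
   of a large multiple of r. *)
have claim j : exists M0, forall M, (M0 <= M)%N -> (j <= N * M)%N /\
    (dilate (N * M + 3 - j) S)° (lattice_pt (u *+ M + c - Q *+ j)).
  elim: j => [|j [M0 IH]].
    exists 0%N => M _; split=> //.
    rewrite subn0 mulr0n subr0 addrC lattice_ptD -rE addnC.
    apply: interior_dilateD => //; last by exists r.
    by rewrite !lattice_ptD; exact: barycenter_interior.
  (* Large enough to use the induction hypothesis at both [M] and [M - K], and to keep the natural
     subtraction from truncating. *)
  exists (M0 + K + j.+1)%N => M M0M.
  have jNM : (j.+1 <= N * M)%N.
    rewrite -[j.+1]mul1n leq_mul// (leq_trans _ M0M)//; exact: leq_addl.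
  split=> //; rewrite subnS.
  have M0M1 : (M0 <= M)%N by rewrite (leq_trans _ M0M)// -addnA leq_addr.
  have KM : (K <= M)%N.
    by rewrite (leq_trans _ M0M)// addnAC leq_addl.
  have M0M2 : (M0 <= M - K)%N.
    by rewrite leq_subRL// addnC (leq_trans _ M0M)// leq_addr.
  have [_ IH1] := IH M M0M1; have [jNMK IH2] := IH _ M0M2.
  apply: sh.
  - by rewrite subn_gt0 (leq_trans jNM)// leq_addr.
  - have -> : (N * M + 3 - j = (N * (M - K) + 3 - j) + N * K)%N.
      rewrite addnBAC; last by rewrite (leq_trans jNMK)// leq_addr.
      by rewrite addnAC -mulnDr subnK.
    (* The induction point for [M - K] plus [N K] times the retreated point. *)
    have -> : lattice_pt (u *+ M + c - Q *+ j.+1 + P) =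
      lattice_pt (u *+ (M - K) + c - Q *+ j) +
      (N * K)%:R *: (r - (N * K)%:R^-1 *: (lattice_pt Q - lattice_pt P)) :> R * R.
      rewrite scalerBr scalerA divff ?gt_eqF// scale1r rE -lattice_ptB -lattice_ptB.
      rewrite -lattice_ptD; congr lattice_pt.
      have {1}-> : M = (M - K + K)%N by rewrite subnK.
      by rewrite mulrnDr mulrSr; ring.
    apply: interior_dilateD => //.
    exists (r - (N * K)%:R^-1 *: (lattice_pt Q - lattice_pt P)) => //.
    apply: retreat_le Sw _ _ => //.
    apply: le_trans Kw; rewrite lef_pV2 ?posrE ?ltr0n// ler_nat.
    exact: leq_pmull.
  - by rewrite mulrSr opprD addrA subrK.
pose L := linear_form a b.
(* The multiples of [r] cancel, leaving a bound independent of [M]; it fails for large [j]. *)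
have le_j j : j%:R * (L r - L (lattice_pt Q)) <= 3 * L r - L (lattice_pt c).
  have [M0 /(_ M0 (leqnn _))[jNM]] := claim j.
  move=> /(@interior_subset _ _ _)/(dilate_form_le rmax).
  rewrite lattice_ptB lattice_ptD -rE lattice_ptMn.
  rewrite linear_formB linear_formD !linear_formZ natrB ?natrD; last first.
    by rewrite (leq_trans jNM)// leq_addr.
  by rewrite -/L; lra.
have d0 : 0 < L r - L (lattice_pt Q) by rewrite subr_gt0.
pose y := (3 * L r - L (lattice_pt c)) / (L r - L (lattice_pt Q)).
have y0 : 0 <= y by rewrite /y divr_ge0 ?(ltW d0)// (le_trans _ (le_j 0%N))// mul0r.
have := archi_boundP y0; rewrite ltr_pdivrMr// => /lt_le_trans/(_ (le_j _)).
by rewrite ltxx.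
Qed.

End LatticeGeometry.

(** * The vertices of the polygon *)

Section NoRetreat.
Context {R : realType}.
Implicit Types (A B C x y z p q v r m : R * R) (S T Delta : set (R * R)).

Lemma hull_seq_nonempty (s : seq (int * int)) x :
  hull (lattice_pt @` [set` s]) x -> exists u, u \in s.
Proof.
case: s => [|u s _]; last by exists u; rewrite mem_head.
move=> h; suff : set0 x by [].
by apply: hull_sub h => [|y [u]//]; apply/convexP.
Qed.

Lemma orient_eq_translate p q x y : p != q -> orient p q x = orient p q y ->
  exists t : R, x = y + t *: (q - p).
Proof.
move=> pq xy; have : line p q (x - y + p).
  by rewrite lineE//=; move: xy; rewrite /orient !coordE; lra.
case=> t _ tE; exists t; apply: (addrI (p - y)).
have -> : p - y + x = x - y + p by apply: pointP; rewrite !coordE; ring.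
by rewrite -tE; apply: pointP; rewrite !coordE; ring.
Qed.

Lemma lattice_pt_off_line Delta p q : lattice_polygon Delta ->
  two_dimensional Delta -> p != q ->
  exists2 u, Delta (lattice_pt u) & orient p q (lattice_pt u) != 0.
Proof.
move=> [s ->] dimD pq; have [x Dx /negP ox] := two_dimensional_off_line pq dimD.
apply: contrapT => noff; apply: ox.
have on u : u \in s -> orient p q (lattice_pt u) = 0.
  move=> us; apply/eqP; apply: contrapT => /negP ou; apply: noff.
  by exists u => //; apply: sub_hull; exists u.
rewrite eq_le -oppr_ge0 -orient_swap.
by apply/andP; split; apply: (orient_hull_ge0 _ Dx) => _ [u us <-];
  rewrite ?(orient_swap p q) on// oppr0.
Qed.

(** At the height of [r] the triangle [p q m] has a slice from [t m + (1 - t) p] to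
    [t m + (1 - t) q]. Either [r] differs from the first end, or the second end is a new point,
    since [t = 1] would give [r = m]. *)
Lemma slice_nontrivial S p q m r (e : R) : @convex_set R (R * R)%type S ->
  p != q -> S p -> S q -> S m -> e != 0 ->
  0 <= e * orient p q r -> e * orient p q r <= e * orient p q m -> r != m ->
  exists2 w : R, w != 0 & S (r + w *: (q - p)).
Proof.
move=> /convexP cS pq Sp Sq Sm e0 r0 rm rNm.
(* The ratio of heights; if [m] has height 0, division by zero gives [t = 0], which is the right
   value. *)
pose t := (e * orient p q r) / (e * orient p q m).
have tE : t * (e * orient p q m) = e * orient p q r.
  have [m0|m0] := eqVneq (e * orient p q m) 0; last by rewrite divfK.
  by apply/eqP; rewrite m0 mulr0 eq_le r0 -m0 rm.
have t0 : 0 <= t by rewrite divr_ge0// (le_trans r0).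
have t1 : t <= 1.
  have [m0|m0] := eqVneq (e * orient p q m) 0.
    by rewrite /t m0 invr0 mulr0 ler01.
  by rewrite ler_pdivrMr ?mul1r// lt0r m0 (le_trans r0).
pose y := t *: m + (1 - t) *: p.
have Sy : S y by exact: cS.
have [|s sE] := @orient_eq_translate p q r y pq.
  by apply: (mulfI e0); rewrite /y orientD orientl mulr0 addr0 mulrCA tE.
have [s0|s0] := eqVneq s 0; last first.
  exists (- s); first by rewrite oppr_eq0.
  by rewrite sE scaleNr addrK.
have ry : r = y by rewrite sE s0 scale0r addr0.
exists (1 - t).
  apply: contra rNm; rewrite subr_eq0 => /eqP t1E.
  by rewrite ry /y -t1E subrr scale0r scale1r addr0.
rewrite ry (_ : _ + _ = t *: m + (1 - t) *: q); first exact: cS.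
by apply: pointP; rewrite /y !coordE; ring.
Qed.

(* The sign e selects one of the two orientations of the plane. *)
Section Vertices.
Variables (s : seq (int * int)) (Delta : set (R * R)) (P Q m1 m2 : int * int).
Variable e : R.
Let p : R * R := lattice_pt P.
Let q : R * R := lattice_pt Q.
Let m : R * R := lattice_pt m1.
Let m' : R * R := lattice_pt m2.
Hypothesis DeltaE : Delta = hull (lattice_pt @` [set` s]).
Hypotheses (pq : p != q) (Dp : Delta p) (Dq : Delta q) (Dm : Delta m) (Dm' : Delta m').
Hypothesis e2 : e * e = 1.
Hypothesis mtop : forall x, Delta x -> e * orient p q x <= e * orient p q m.
Hypothesis mbot : forall x, Delta x -> e * orient p q m' <= e * orient p q x.
Hypothesis rpq : no_retreat p q Delta.

Let e0 : e != 0.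
Proof. by apply/eqP => e0; move: e2; rewrite e0 mul0r => /esym/eqP; rewrite oner_eq0. Qed.

Let cD : @convex_set R (R * R)%type Delta.
Proof. by rewrite DeltaE; exact: hull_convex. Qed.

(** A maximizing vertex [r] that beats [q] cannot move along [q - p], where the form would grow, nor
    backwards, by [no_retreat]. Its slice is therefore a point, so [slice_nontrivial] leaves only
    [m] and [m']. *)
Lemma form_max_vertex (a b : R) : linear_form a b p < linear_form a b q ->
  [\/ forall x, Delta x -> linear_form a b x <= linear_form a b q,
      linear_form a b q < linear_form a b m /\
        forall x, Delta x -> linear_form a b x <= linear_form a b m |
      linear_form a b q < linear_form a b m' /\
        forall x, Delta x -> linear_form a b x <= linear_form a b m'].
Proof.
move=> lpq.
have [r0 r0s] : exists u, u \in s by apply: (@hull_seq_nonempty _ p); rewrite -DeltaE.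
have [r1 r1s] := seq_form_max a b r0s; rewrite -DeltaE.
set r := lattice_pt r1 => rmax.
have Dr : Delta r by rewrite DeltaE; apply: sub_hull; exists r1.
have [rq|qr] := leP (linear_form a b r) (linear_form a b q).
  by constructor 1 => x /rmax xr; exact: le_trans rq.
have noslice : ~ exists2 w : R, w != 0 & Delta (r + w *: (q - p)).
  move=> [w w0 Dw]; have := rmax _ Dw.
  rewrite linear_formD gerDl linear_formZ linear_formB pmulr_lle0 ?subr_gt0//.
  move=> w0'; apply: (rpq (N := 1) (u := r1) Dr _ _ rmax qr (w := - w)) => //.
  - by rewrite scale1r.
  - by rewrite oppr_gt0 lt_neqAle w0.
  - by rewrite scaleNr opprK.
have [ro|ro] := leP 0 (e * orient p q r).
  have [rm|rm] := eqVneq r m; first by constructor 2; rewrite -rm.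
  by case: noslice; apply: slice_nontrivial cD pq Dp Dq Dm e0 ro (mtop Dr) rm.
have [rm|rm] := eqVneq r m'; first by constructor 3; rewrite -rm.
case: noslice; apply: (@slice_nontrivial Delta p q m' r (- e)) => //.
- by rewrite oppr_eq0.
- by rewrite mulNr oppr_ge0 ltW.
- by rewrite !mulNr lerN2 mbot.
Qed.

(** Apply [form_max_vertex] to the form constant along [q m] and growing from [p] to [q]: a maximum
    at [q] is the claim, and [m] cannot exceed [q]. The work lies in excluding [m']. *)
Lemma top_edge_supports : 0 < e * orient p q m ->
  forall x, Delta x -> 0 <= e * orient q m x.
Proof.
move=> m0.
pose a := e * (m.2 - q.2); pose b := e * (q.1 - m.1).
have lE x : linear_form a b x = linear_form a b q - e * orient q m x.
  by rewrite /linear_form /a /b /orient; ring.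
have [||[lm _]|[lm' _]] := @form_max_vertex a b.
- by rewrite lE (orient_rot p q m) gtrDl oppr_lt0.
- by move=> lq x /lq; rewrite lE gerDl oppr_le0.
- by move: lm; rewrite (lE m) orientr mulr0 subr0 ltxx.
(* Otherwise q lies strictly on one side of the line through m and m', and the
   point g where that line meets the line p q violates no_retreat. *)
exfalso; move: lm'; rewrite (lE m') ltrDl oppr_gt0 => m'0.
pose a' := e * (m.2 - m'.2); pose b' := e * (m'.1 - m.1).
have lE' x : linear_form a' b' x = linear_form a' b' m - e * orient m' m x.
  by rewrite /linear_form /a' /b' /orient; ring.
have m'le0 : e * orient p q m' <= 0.
  by have := mbot Dp; rewrite orientl mulr0.
have lmq : linear_form a' b' q < linear_form a' b' m.
  rewrite lE' gtrDl oppr_lt0; move: m'0.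
  by rewrite -(orient_rot q m) orient_swap mulrN oppr_lt0.
have lpq' : linear_form a' b' p < linear_form a' b' q.
  rewrite -subr_gt0 (_ : _ - _ = e * orient p q m - e * orient p q m').
    by rewrite subr_gt0 (le_lt_trans m'le0).
  by rewrite /linear_form /a' /b' /orient; ring.
have lm'm : linear_form a' b' m' = linear_form a' b' m.
  by rewrite lE' orientl mulr0 subr0.
have lmax : forall x, Delta x -> linear_form a' b' x <= linear_form a' b' m.
  have [/(_ _ Dm)|[_]|[_]] := form_max_vertex lpq'; rewrite ?lm'm//.
  by rewrite leNgt lmq.
have e01 : e = 1 \/ e = -1.
  have : (e - 1) * (e + 1) = 0 by rewrite -(subrr (1 : R)) -{3}e2; ring.
  by move/eqP; rewrite mulf_eq0 subr_eq0 addr_eq0 => /orP[]/eqP->; [left|right].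
have nat_height u : 0 <= e * orient p q (lattice_pt u) ->
    exists n : nat, e * orient p q (lattice_pt u) = n%:R.
  case: e01 => ->; first by rewrite mul1r; exact: orient_lattice_nat.
  rewrite mulN1r -orient_swap; exact: orient_lattice_nat.
have nat_depth u : e * orient p q (lattice_pt u) <= 0 ->
    exists n : nat, e * orient p q (lattice_pt u) = - n%:R.
  case: e01 => ->; rewrite ?mul1r ?mulN1r ?oppr_le0.
    rewrite -oppr_ge0 -orient_swap => /orient_lattice_nat[n nE]; exists n.
    by rewrite -nE orient_swap.
  by move=> /orient_lattice_nat[n nE]; exists n; rewrite nE.
have [n nE] := nat_height _ (ltW m0).
have [n' n'E] := nat_depth _ m'le0.
rewrite -/m in nE; rewrite -/m' in n'E.
have n0 : 0 < n%:R :> R by rewrite -nE.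
have n'0 : 0 <= n'%:R :> R by [].
(* The heights [n] and [- n'] of [m] and [m'] cancel with these weights, and [n + n'] clears the
   denominators of [g]. *)
pose t : R := n%:R / (n%:R + n'%:R).
have nn0 : 0 < n%:R + n'%:R :> R by lra.
pose g := t *: m' + (1 - t) *: m.
have Dg : Delta g.
  have /convexP := cD; apply=> //; first by rewrite divr_ge0// ltW.
  by rewrite ler_pdivrMr// mul1r lerDl.
have og : orient p q g = 0.
  apply: (mulfI e0); rewrite mulr0 /g orientD mulrDr !(mulrCA e) nE n'E /t.
  by field; lra.
have lg : linear_form a' b' g = linear_form a' b' m.
  by rewrite /g linear_formD !linear_formZ lm'm; ring.
have [w gE] := @orient_eq_translate p q g q pq (etrans og (esym (orientr p q))).
have lqg : linear_form a' b' q < linear_form a' b' g by rewrite lg.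
(* The form is larger at [g] than at [q], so [g] lies beyond [q], and retreating by [w] lands on [q]
   itself. *)
apply: (@rpq a' b' w g (n + n')%N (m2 *+ n + m1 *+ n')) => //.
- by rewrite -(ltr0n R) natrD.
- rewrite lattice_ptD !lattice_ptMn natrD -/m -/m' /g /t.
  by apply: pointP; rewrite !coordE; field; lra.
- by rewrite lg.
- move: lqg; rewrite gE linear_formD ltrDl linear_formZ linear_formB.
  by rewrite pmulr_lgt0// subr_gt0.
- by rewrite gE addrK.
Qed.

End Vertices.

(** All four edges come from [top_edge_supports] by exchanging [p] with [q] or [m] with [m'], the
    sign [e] correcting the orientation. A side of height 0 leaves a triangle; two such sides
    contradict two-dimensionality. *)
Lemma no_retreat_diagonal Delta P Q : lattice_polygon Delta ->
  two_dimensional Delta -> P != Q ->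
  Delta (lattice_pt P) -> Delta (lattice_pt Q) ->
  no_retreat (lattice_pt P) (lattice_pt Q) Delta ->
  no_retreat (lattice_pt Q) (lattice_pt P) Delta ->
  diagonal (lattice_pt P) (lattice_pt Q) Delta.
Proof.
move=> [s DE] dimD PQ Dp Dq; set p := lattice_pt P; set q := lattice_pt Q.
rewrite -/p -/q in Dp Dq; move=> rpq rqp.
have pq : p != q by apply: contra PQ => /eqP/lattice_pt_inj ->.
have qp : q != p by rewrite eq_sym.
have [r0 r0s] : exists u, u \in s by apply: (@hull_seq_nonempty _ p); rewrite -DE.
have [m1 m1s] := seq_form_max (p.2 - q.2) (q.1 - p.1) r0s; rewrite -DE => m1max.
have [m2 m2s] := seq_form_max (q.2 - p.2) (p.1 - q.1) r0s; rewrite -DE => m2max.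
pose m : R * R := lattice_pt m1; pose m' : R * R := lattice_pt m2.
have Dm : Delta m by rewrite DE; apply: sub_hull; exists m1.
have Dm' : Delta m' by rewrite DE; apply: sub_hull; exists m2.
have mtop x : Delta x -> orient p q x <= orient p q m.
  by move=> /m1max; rewrite !orient_form lerD2r.
have mbot x : Delta x -> orient q p x <= orient q p m'.
  by move=> /m2max; rewrite !orient_form lerD2r.
have oqp x : orient q p x = - orient p q x by rewrite orient_swap.
have s1 : (1 : R) * 1 = 1 by rewrite mulr1.
have sN1 : (-1 : R) * -1 = 1 by rewrite mulrNN mulr1.
have qm : 0 < orient p q m -> forall x, Delta x -> 0 <= orient q m x.
  move=> m0 x Dx; rewrite -[leRHS]mul1r.
  apply: (@top_edge_supports s Delta P Q m1 m2 1 DE) => //.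
  - by move=> y /mtop; rewrite !mul1r.
  - by move=> y /mbot; rewrite !mul1r !oqp lerN2.
  - by rewrite mul1r.
have mp : 0 < orient p q m -> forall x, Delta x -> 0 <= orient m p x.
  move=> m0 x Dx; rewrite orient_swap -mulN1r.
  apply: (@top_edge_supports s Delta Q P m1 m2 (-1) DE) => //.
  - by move=> y /mtop; rewrite !mulN1r !oqp !opprK.
  - by move=> y /mbot; rewrite !mulN1r lerN2.
  - by rewrite mulN1r oqp opprK.
have pm' : 0 < orient q p m' -> forall x, Delta x -> 0 <= orient p m' x.
  move=> m0 x Dx; rewrite -[leRHS]mul1r.
  apply: (@top_edge_supports s Delta Q P m2 m1 1 DE) => //.
  - by move=> y /mbot; rewrite !mul1r.
  - by move=> y /mtop; rewrite !mul1r !oqp lerN2.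
  - by rewrite mul1r.
have m'q : 0 < orient q p m' -> forall x, Delta x -> 0 <= orient m' q x.
  move=> m0 x Dx; rewrite orient_swap -mulN1r.
  apply: (@top_edge_supports s Delta P Q m2 m1 (-1) DE) => //.
  - by move=> y /mbot; rewrite !mulN1r !oqp.
  - by move=> y /mtop; rewrite !mulN1r lerN2.
  - by rewrite mulN1r -oqp.
have m0 : 0 <= orient p q m by have := mtop _ Dp; rewrite orientl.
have m'0 : 0 <= orient q p m' by have := mbot _ Dp; rewrite orientr.
have upper x : 0 < orient p q m -> Delta x -> 0 <= orient p q x ->
    hull [set p; q; m] x.
  by move=> mp0 Dx x0; apply: hull3P => //; [exact: qm|exact: mp].
have lower x : 0 < orient q p m' -> Delta x -> orient p q x <= 0 ->
    hull [set p; q; m'] x.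
  move=> mp0 Dx x0; rewrite (setUC [set p]); apply: hull3P => //.
  - by rewrite oqp oppr_ge0.
  - exact: pm'.
  - exact: m'q.
have [mp0|mp0] := ltP 0 (orient p q m); have [m'p0|m'p0] := ltP 0 (orient q p m').
- left; exists m', m; split.
  + have pNm : p != m by apply/eqP => pm; move: mp0; rewrite -pm orientl ltxx.
    have qNm : q != m by apply/eqP => qm_; move: mp0; rewrite -qm_ orientr ltxx.
    have pNm' : p != m' by apply/eqP => pm; move: m'p0; rewrite -pm orientr ltxx.
    have qNm' : q != m' by apply/eqP => qm_; move: m'p0; rewrite -qm_ orientl ltxx.
    have mNm' : m' != m.
      apply/eqP => mm; move: m'p0; rewrite mm oqp oppr_gt0.
      by rewrite ltNge ltW.
    by rewrite /= !inE !negb_or pNm' pq pNm mNm' qNm (eq_sym m') qNm'.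
  + by split; [exact: pm'|exact: m'q].
  + by split; [exact: qm|exact: mp].
  + apply/seteqP; split=> x.
      move=> Dx; have [x0|x0] := leP 0 (orient p q x).
        by apply: hullS (upper x mp0 Dx x0) => y [[->|->]|->];
          [left; left; left|left; right|right].
      by apply: hullS (lower x m'p0 Dx (ltW x0)) => y [[->|->]|->];
        [left; left; left|left; right|left; left; right].
    apply: hull_sub; first by rewrite DE; exact: hull_convex.
    by move=> y [[[->|->]|->]|->].
- right; exists m; split; first by rewrite gt_eqF.
  apply/seteqP; split=> x.
    move=> Dx; apply: upper => //.
    by rewrite -oppr_le0 -oqp (le_trans (mbot _ Dx)).
  apply: hull_sub; first by rewrite DE; exact: hull_convex.
  by move=> y [[->|->]|->].
- right; exists m'; split; first by rewrite orient_swap oppr_eq0 gt_eqF.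
  apply/seteqP; split=> x.
    by move=> Dx; apply: lower => //; rewrite (le_trans (mtop _ Dx)).
  apply: hull_sub; first by rewrite DE; exact: hull_convex.
  by move=> y [[->|->]|->].
- have [x Dx] := two_dimensional_off_line pq dimD.
  rewrite eq_le (le_trans (mtop _ Dx) mp0)/= -oppr_le0 -oqp.
  by rewrite (le_trans (mbot _ Dx) m'p0).
Qed.

End NoRetreat.

(** * The cycle of implications *)

Theorem theorem7p4 (k : fieldType) (char0 : [pchar k] =i pred0)
    (R : realType) (Delta : set (R * R))
    (polyDelta : lattice_polygon Delta) (dimDelta : two_dimensional Delta)
    (P Q : int * int) (PDelta : Delta (lattice_pt P))
    (QDelta : Delta (lattice_pt Q)) (neqPQ : P != Q) :
  let p : R * R := lattice_pt P in
  let q : R * R := lattice_pt Q in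
  [<->
    (* (1) *)
    regular_sequence (polygon_module k Delta) [:: P; Q];
    (* (2) *)
    regular_sequence (inner_module k Delta) [:: P; Q];
    (* (3) *)
    exists2 n : nat, (1 < n)%N &
      translN (dilate n Delta) p `&` translN (dilate n Delta) q
        `<=` dilate n.-1 Delta;
    (* (4) *)
    forall n : nat, (1 <= n)%N ->
      translN (dilate n Delta) p `&` translN (dilate n Delta) q
        `<=` dilate n.-1 Delta;
    (* (5) *)
    forall n : nat, (1 <= n)%N ->
      translN (dilate n Delta)° p `&` translN (dilate n Delta)° q
        `<=` (dilate n.-1 Delta)°;
    (* (6) *)
    forall n : nat, (1 <= n)%N ->
      translN (inner_hull (dilate n Delta)) p
        `&` translN (inner_hull (dilate n Delta)) q `&` Zlattice
        `<=` inner_hull (dilate n.-1 Delta) `&` Zlattice;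
    (* (7) *)
    forall n : nat, (1 <= n)%N ->
      translN (dilate n Delta) p `&` translN (dilate n Delta) q `&` Zlattice
        `<=` dilate n.-1 Delta `&` Zlattice;
    (* (8) *)
    forall H : set (R * R), halfplane_bordered_by (line p q) H ->
      (exists A, triangle p q A (H `&` Delta)) \/
      H `&` Delta = hull [set p; q];
    (* (9) *)
    (exists A B, quadrangle p A q B Delta) \/
    (exists A, triangle p q A Delta)
  ].
Proof.
move=> p q.
have cD : @convex_set R (R * R)%type Delta.
  by case: polyDelta => s ->; exact: hull_convex.
have cdD n : @convex_set R (R * R)%type (dilate n Delta) by exact: dilate_convex.
have pq : p != q by apply: contra neqPQ => /eqP/lattice_pt_inj ->.
have qp : q != p by rewrite eq_sym.
have QP : Q != P by rewrite eq_sym.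
have dilate0 (u : int * int) : dilate 0 Delta (lattice_pt u) -> u = 0.
  by move=> [x _]; rewrite scale0r => u0; apply: (@lattice_pt_inj R); rewrite -u0.
(* The dilate by 0 is at most a point, whereas a neighbourhood contains two distinct points. *)
have inner0 (u : int * int) : ~ inner_hull (dilate 0 Delta) (lattice_pt u).
  move=> /(inner_hullE _ (cdD 0%N))/interiorP[e e0 ue].
  have [|//|x _] := ue ((lattice_pt u).1 + e / 2, (lattice_pt u).2).
  - by rewrite /= addrAC subrr add0r gtr0_norm ?divr_gt0//; lra.
  - by rewrite /= subrr normr0.
  have [|//|y _] := ue (lattice_pt u); rewrite ?subrr ?normr0// !scale0r.
  by move=> <- /(congr1 fst) /=; lra.
have inner_pt n u : inner_hull (dilate n Delta) (lattice_pt u) <->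
  (dilate n Delta)° (lattice_pt u) by exact: inner_hullE.
have reg1 : regular_sequence (polygon_module k Delta) [:: P; Q] <->
    lattice_shift (fun n => dilate n Delta) P Q.
  by apply: regular_sequence2P => // [i u []|u v /dilate0 -> /dilate0 ->].
have shift2 : lattice_shift (fun n => inner_hull (dilate n Delta)) P Q <->
    lattice_shift (fun n => (dilate n Delta)°) P Q.
  by split=> sh n u n0 /inner_pt Su /inner_pt Sv; apply/inner_pt; exact: (sh n).
have reg2 : regular_sequence (inner_module k Delta) [:: P; Q] <->
    lattice_shift (fun n => inner_hull (dilate n Delta)) P Q.
  apply: regular_sequence2P => // [[|i] u /= ni|u v /inner0//]; first exact: inner0.
  by case: ni.
pose shift4 := forall n : nat, (1 <= n)%N ->
  translN (dilate n Delta) p `&` translN (dilate n Delta) q `<=` dilate n.-1 Delta.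
have shiftC S : lattice_shift S P Q -> lattice_shift S Q P :> Prop.
  by move=> sh n u n0 SP SQ; exact: (sh n).
have diag rpq rqp := no_retreat_diagonal polyDelta dimDelta neqPQ PDelta QDelta rpq rqp.
have halves_shift4 : half_triangle p q Delta -> half_triangle q p Delta -> shift4.
  by move=> h1 h2 n n0; exact: half_triangles_dilate.
have diag_halves : diagonal p q Delta ->
    half_triangle p q Delta /\ half_triangle q p Delta.
  move=> d; split; first exact: diagonal_half_triangle.
  exact/diagonal_half_triangle/diagonal_sym.
have diag_shift4 : diagonal p q Delta -> shift4.
  by move=> /diag_halves[]; exact: halves_shift4.
have shift3_diag n : (1 < n)%N ->
    translN (dilate n Delta) p `&` translN (dilate n Delta) q
      `<=` dilate n.-1 Delta -> diagonal p q Delta.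
  move=> n1 sh; apply: diag; first exact: no_retreat_real n1 sh.
  by apply: (@no_retreat_real _ _ _ _ n) => //; rewrite setIC.
have shift7_diag : lattice_shift (fun n => dilate n Delta) P Q -> diagonal p q Delta.
  by move=> sh; apply: diag; apply: no_retreat_dilate => //; exact: shiftC.
have shift6_diag : lattice_shift (fun n => (dilate n Delta)°) P Q ->
    diagonal p q Delta.
  have [X DX oX] := lattice_pt_off_line polyDelta dimDelta pq.
  move=> sh; apply: diag; apply: (no_retreat_interior (X := X)) => //.
    by rewrite orient_swap oppr_eq0.
  exact: shiftC.
have shift45 : shift4 -> forall n : nat, (1 <= n)%N ->
    translN (dilate n Delta)° p `&` translN (dilate n Delta)° q
      `<=` (dilate n.-1 Delta)°.
  by move=> sh n n1; apply: interior_translN; exact: sh.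
have shift56 : (forall n : nat, (1 <= n)%N ->
    translN (dilate n Delta)° p `&` translN (dilate n Delta)° q
      `<=` (dilate n.-1 Delta)°) ->
    lattice_shift (fun n => (dilate n Delta)°) P Q.
  by move=> sh; apply/lattice_shiftP => n n1; apply: setSI; exact: sh.
have shift47 : shift4 -> lattice_shift (fun n => dilate n Delta) P Q.
  by move=> sh; apply/lattice_shiftP => n n1; apply: setSI; exact: sh.
tfae.
- by move=> /reg1/shift7_diag/diag_shift4/shift45/shift56/shift2/reg2.
- move=> /reg2/shift2/shift6_diag/diag_shift4 sh.
  by exists 2%N => //; exact: sh.
- by move=> [n n1 sh]; exact/diag_shift4/shift3_diag/sh.
- exact: shift45.
- by move=> /shift56/shift2/lattice_shiftP.
- move=> /lattice_shiftP/shift2/shift6_diag/diag_shift4/shift47.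
  by move=> /lattice_shiftP.
- move=> /lattice_shiftP/shift7_diag/diag_halves[h1 h2] H /(halfplane_borderedE pq)[]->.
    exact: h1.
  case: h2 => [[A T]|->]; first by left; exists A; exact: triangle_sym.
  by right; rewrite setUC.
(* The two halves are not glued directly: they give (4), whose case [n = 2] is an instance of (3),
   and (3) gives (9). *)
- move=> h; suff : diagonal p q Delta by [].
  have h1 : half_triangle p q Delta by apply: h; exact: halfplane_orient.
  have h2 : half_triangle q p Delta.
    have hb : halfplane_bordered_by (line p q) [set v | 0 <= orient q p v].
      by rewrite line_sym//; exact: halfplane_orient.
    case: (h _ hb) => [[A T]|E]; first by left; exists A; exact: triangle_sym.
    by right; rewrite E setUC.
  exact: (shift3_diag 2%N isT (halves_shift4 h1 h2 2%N isT)).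
- by move=> /diag_shift4/shift47/reg1.
Qed.
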